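(* Let $\mathbb H=(A,\prec,\mathcal C)$ be an sp-algebra such that $\mathcal C\subseteq\mathcal C_\prec$. 1. For each $\mathrm{(X)}\in\{\mathrm{(WO)},\mathrm{(SI)}\}$, the relation $S^{\mathrm{(X)}}(\prec,\mathcal C)$ on $A$ satisfies $\mathrm{(X)}$. 2. For each $\mathrm{(X)}\in\{\mathrm{(AND)},\mathrm{(OR)}\}$, if $\mathbb H$ is lattice-based (i.e. $A$ is a lattice) and $\mathrm{(X)}$-updirected, then the relation $S^{\mathrm{(X)}}(\prec,\mathcal C)$ on $A$ satisfies $\mathrm{(X)}$.
   Context: Conditions on a binary relation $R$ on $A$: (SI) $a\le b\ \&\ b\,R\,x\Rightarrow a\,R\,x$; (WO) $b\,R\,x\ \&\ x\le y\Rightarrow b\,R\,y$; (AND) $a\,R\,x\ \&\ a\,R\,y\Rightarrow a\,R\,(x\wedge y)$; (OR) $a\,R\,x\ \&\ b\,R\,x\Rightarrow(a\vee b)\,R\,x$. An sp-algebra is $(A,\prec,\mathcal C)$, with $A$ a bounded lattice, such that $(A,\prec)$ is a subordination algebra, i.e. $\prec$ satisfies $\bot\prec\bot$, $\top\prec\top$, (SI), (WO), (AND), (OR); and $(A,\mathcal C)$ is a precontact algebra, i.e. $\overline{\mathcal C}=(A\times A)\setminus\mathcal C$ satisfies $\bot\,\overline{\mathcal C}\,\top$; $\top\,\overline{\mathcal C}\,\bot$; $b\,\overline{\mathcal C}\,c\ \&\ a\le b\Rightarrow a\,\overline{\mathcal C}\,c$; $a\,\overline{\mathcal C}\,c\ \&\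 b\le c\Rightarrow a\,\overline{\mathcal C}\,b$; $a\,\overline{\mathcal C}\,b\ \&\ a\,\overline{\mathcal C}\,c\Rightarrow a\,\overline{\mathcal C}\,(b\vee c)$; $a\,\overline{\mathcal C}\,c\ \&\ b\,\overline{\mathcal C}\,c\Rightarrow(a\vee b)\,\overline{\mathcal C}\,c$. $A$ is assumed to belong to the class $\mathsf{Alg}(\mathcal L)$ of a fixed (fully) selfextensional logic $\mathcal L=(\mathrm{Fm},\vdash)$. An $\mathcal L$-filter of $A$ is a subset $F\subseteq A$ such that for every $\Gamma\cup\{\varphi\}\subseteq\mathrm{Fm}$ with $\Gamma\vdash\varphi$ and every homomorphism $h:\mathrm{Fm}\to A$, $h[\Gamma]\subseteq F$ implies $h(\varphi)\in F$; $A\in\mathsf{Alg}(\mathcal L)$ means that distinct elements of $A$ are separated by $\mathcal L$-filters, and $A$ is ordered by $a\le b$ iff every $\mathcal L$-filter containing $a$ contains $b$. $F(b,c)$ is the $\mathcal L$-filter generated by $\{b,c\}$, and $\mathcal C_\prec:=\{(a,b)\mid\forall c\,(a\prec c\Rightarrow F(b,c)\ne A)\}$. For a Horn-type condition (R) and $a,b\in A$, $\prec^{\mathrm{(R)}}$ is the smallest superset of $\prec$ satisfying (R), and $\prec^{\mathrm{(R)}}_{(a,b)}$ is the smallest superset of $\prec\cup\{(a,b)\}$ satisfying (R). $S^{\mathrm{(R)}}(\prec,\mathcal C):=\bigcup\{\prec^{\mathrm{(R)}}_{(a,b)}\mid(a,b)\in\mathcal C\}$ if $\mathcal C\ne\varnothing$,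 and $S^{\mathrm{(R)}}(\prec,\mathcal C):=\prec^{\mathrm{(R)}}$ otherwise. $\mathbb H$ is (R)-updirected if for all $a,b,c,d\in A$ with $a\,\mathcal C\,b$ and $c\,\mathcal C\,d$ there are $e,f\in A$ with $e\,\mathcal C\,f$ and $\prec^{\mathrm{(R)}}_{(a,b)}\cup\prec^{\mathrm{(R)}}_{(c,d)}\ \subseteq\ \prec^{\mathrm{(R)}}_{(e,f)}$. *)

(* Defs.v *)
From mathcomp Require Import all_boot all_order.
From mathcomp Require Import boolp classical_sets.

Set Implicit Arguments.
Unset Strict Implicit.
Unset Printing Implicit Defensive.

Local Open Scope classical_set_scope.

Record signature := Signature {
  op : Type;
  arity : op -> nat }.

Definition operations (S : signature) (T : Type) :=
  forall f : op S, ('I_(arity f) -> T) -> T.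

Definition is_hom (S : signature) (T U : Type)
    (I : operations S T) (J : operations S U) (h : T -> U) : Prop :=
  forall (f : op S) (x : 'I_(arity f) -> T), h (I f x) = J f (fun i => h (x i)).

Definition is_congruence (S : signature) (T : Type) (I : operations S T)
    (E : T -> T -> Prop) : Prop :=
  [/\ forall x, E x x,
      forall x y, E x y -> E y x,
      forall x y z, E x y -> E y z -> E x z &
      forall (f : op S) (x y : 'I_(arity f) -> T),
        (forall i, E (x i) (y i)) -> E (I f x) (I f y)].

Inductive fm (S : signature) (V : Type) : Type :=
| fm_var of V
| fm_app (f : op S) of 'I_(arity f) -> fm S V.
Arguments fm_app {S V} f _.

Definition fm_ops (S : signature) (V : Type) : operations S (fm S V) :=
  fun f x => fm_app f x.

Record logic (S : signature) (V : Type) := Logic {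
  entails : set (fm S V) -> fm S V -> Prop;
  entails_refl : forall (G : set (fm S V)) p, G p -> entails G p;
  entails_mono : forall (G D : set (fm S V)) p,
    G `<=` D -> entails G p -> entails D p;
  entails_cut : forall (G D : set (fm S V)) p,
    entails D p -> (forall q, D q -> entails G q) -> entails G p;
  entails_subst : forall s : fm S V -> fm S V,
    is_hom (@fm_ops S V) (@fm_ops S V) s ->
    forall (G : set (fm S V)) p, entails G p -> entails (s @` G) (s p) }.

Section Logic.
Variables (S : signature) (V : Type) (L : logic S V).

Definition interderivable (p q : fm S V) : Prop :=
  entails L [set p] q /\ entails L [set q] p.

Definition selfextensional : Prop :=
  is_congruence (@fm_ops S V) interderivable.

Definition is_Lfilter (T : Type) (I : operations S T) : set (set T) :=
  [set F | forall (G : set (fm S V)) (p : fm S V), entails L G p ->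
    forall h : fm S V -> T, is_hom (@fm_ops S V) I h ->
    h @` G `<=` F -> F (h p)].

Definition in_Alg (T : Type) (I : operations S T) : Prop :=
  forall a b : T, a <> b -> exists F, is_Lfilter I F /\ ~ (F a <-> F b).

Definition Lfilter_order (T : Type) (I : operations S T) (a b : T) : Prop :=
  forall F, is_Lfilter I F -> F a -> F b.

Definition Lfilter_gen2 (T : Type) (I : operations S T) (b c : T) : set T :=
  smallest (is_Lfilter I) [set b; c].

Definition contact_of (T : Type) (I : operations S T) (prec : set (T * T)) :
    set (T * T) :=
  [set ab | forall c, prec (ab.1, c) -> Lfilter_gen2 I ab.2 c <> setT].

End Logic.

Section Conditions.
Context {d : Order.disp_t} {A : tbLatticeType d}.

Definition SI : set (set (A * A)) :=
  [set R | forall a b x, (a <= b)%O -> R (b, x) -> R (a, x)].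

Definition WO : set (set (A * A)) :=
  [set R | forall b x y, R (b, x) -> (x <= y)%O -> R (b, y)].

Definition AND : set (set (A * A)) :=
  [set R | forall a x y, R (a, x) -> R (a, y) -> R (a, (x `&` y)%O)].

Definition OR : set (set (A * A)) :=
  [set R | forall a b x, R (a, x) -> R (b, x) -> R ((a `|` b)%O, x)].

Record subordination_algebra (prec : set (A * A)) : Prop := {
  sub_bot : prec (\bot%O, \bot%O);
  sub_top : prec (\top%O, \top%O);
  sub_SI : SI prec;
  sub_WO : WO prec;
  sub_AND : AND prec;
  sub_OR : OR prec }.

Record precontact_algebra (C : set (A * A)) : Prop := {
  pre_bot_top : (~` C) (\bot%O, \top%O);
  pre_top_bot : (~` C) (\top%O, \bot%O);
  pre_lel : forall a b c, (~` C) (b, c) -> (a <= b)%O -> (~` C) (a, c);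
  pre_ler : forall a b c, (~` C) (a, c) -> (b <= c)%O -> (~` C) (a, b);
  pre_joinr : forall a b c,
    (~` C) (a, b) -> (~` C) (a, c) -> (~` C) (a, (b `|` c)%O);
  pre_joinl : forall a b c,
    (~` C) (a, c) -> (~` C) (b, c) -> (~` C) ((a `|` b)%O, c) }.

(* The lattice meet and join are those of the order determined by the
   L-filters; they need not be operations of the signature S. Since the carrier is a
   tbLatticeType, every sp-algebra is lattice-based. *)
Record sp_algebra (S : signature) (V : Type) (L : logic S V)
    (I : operations S A) (prec C : set (A * A)) : Prop := {
  sp_Alg : in_Alg L I;
  sp_order : forall a b : A, (a <= b)%O <-> Lfilter_order L I a b;
  sp_subordination : subordination_algebra prec;
  sp_precontact : precontact_algebra C }.

Definition rel_closure (X : set (set (A * A))) (prec : set (A * A)) :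
    set (A * A) :=
  smallest X prec.

Definition rel_closure_at (X : set (set (A * A))) (prec : set (A * A))
    (p : A * A) : set (A * A) :=
  smallest X (prec `|` [set p]).

Definition S_rel (X : set (set (A * A))) (prec C : set (A * A)) :
    set (A * A) :=
  if `[< C !=set0 >] then \bigcup_(p in C) rel_closure_at X prec p
  else rel_closure X prec.

Definition updirected (X : set (set (A * A))) (prec C : set (A * A)) : Prop :=
  forall a b c d : A, C (a, b) -> C (c, d) ->
  exists e f : A, C (e, f) /\
    rel_closure_at X prec (a, b) `|` rel_closure_at X prec (c, d)
      `<=` rel_closure_at X prec (e, f).

End Conditions.

(* Main.v *)
(** Each of the four conditions is Horn, hence inherited by intersections, so
that the closures satisfy it. (WO) and (SI) have a single relational premise and
are therefore inherited by arbitrary unions; (AND) and (OR) have two, and are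
inherited by unions of families in which any two members lie below a third,
which is what updirectedness provides. *)
Require Import Defs.
From mathcomp Require Import all_boot all_order.
From mathcomp Require Import boolp classical_sets.

Local Open Scope classical_set_scope.

Section HornConditions.
Context {d : Order.disp_t} {A : tbLatticeType d}.
Implicit Types (X : set (set (A * A))) (D prec C : set (A * A)).

(** The premise pair lies in every competitor [M] of the intersection, and each [M] is itself closed
    under the rule. *)
Lemma WO_smallest D : WO (smallest WO D).
Proof. by move=> b x y bx xy M [MX DM]; apply: (MX b x y) => //; apply: bx. Qed.

Lemma SI_smallest D : SI (smallest SI D).
Proof. by move=> a b x ab bx M [MX DM]; apply: (MX a b x ab); apply: bx. Qed.

Lemma AND_smallest D : AND (smallest AND D).
Proof. by move=> a x y ax ay M [MX DM]; apply: (MX a x y); [apply: ax | apply: ay]. Qed.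

Lemma OR_smallest D : OR (smallest OR D).
Proof. by move=> a b x ax bx M [MX DM]; apply: (MX a b x); [apply: ax | apply: bx]. Qed.

Lemma WO_bigcup (T : Type) (P : set T) (F : T -> set (A * A)) :
  (forall i, P i -> WO (F i)) -> WO (\bigcup_(i in P) F i).
Proof. by move=> FX b x y [i Pi bx] xy; exists i => //; apply: (FX i Pi b x y). Qed.

Lemma SI_bigcup (T : Type) (P : set T) (F : T -> set (A * A)) :
  (forall i, P i -> SI (F i)) -> SI (\bigcup_(i in P) F i).
Proof. by move=> FX a b x ab [i Pi bx]; exists i => //; apply: (FX i Pi a b x). Qed.

Definition directed_family (T : Type) (P : set T) (F : T -> set (A * A)) :=
  forall i j, P i -> P j -> exists2 k, P k & F i `|` F j `<=` F k.

(** The two premises may come from different members [F i] and [F j]; the rule is applied inside a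
    single [F k] that contains both. *)
Lemma AND_bigcup (T : Type) (P : set T) (F : T -> set (A * A)) :
  directed_family T P F ->
  (forall i, P i -> AND (F i)) -> AND (\bigcup_(i in P) F i).
Proof.
move=> dirF FX a x y [i Pi ax] [j Pj ay].
have [k Pk ijk] := dirF i j Pi Pj; exists k => //.
by apply: (FX k Pk a x y); apply: ijk; [left | right].
Qed.

Lemma OR_bigcup (T : Type) (P : set T) (F : T -> set (A * A)) :
  directed_family T P F ->
  (forall i, P i -> OR (F i)) -> OR (\bigcup_(i in P) F i).
Proof.
move=> dirF FX a b x [i Pi ax] [j Pj bx].
have [k Pk ijk] := dirF i j Pi Pj; exists k => //.
by apply: (FX k Pk a b x); apply: ijk; [left | right].
Qed.

Lemma updirected_family X prec C :
  updirected X prec C -> directed_family _ C (rel_closure_at X prec).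
Proof.
move=> updir [a b] [c e] Cab Cce.
by have [f [g [Cfg sub]]] := updir _ _ _ _ Cab Cce; exists (f, g).
Qed.

(** Treats all four conditions at once: the second hypothesis leaves open how [X] passes to the
    union, so that directedness can enter for (AND) and (OR) only. *)
Lemma S_rel_horn X prec C :
  (forall D, X (smallest X D)) ->
  ((forall p, C p -> X (rel_closure_at X prec p)) ->
    X (\bigcup_(p in C) rel_closure_at X prec p)) ->
  X (S_rel X prec C).
Proof.
(* For empty [C] the relation is the closure of [prec] alone, a single [smallest]. *)
move=> Xsmallest XU; rewrite /S_rel; case: ifP => _; last exact: Xsmallest.
(* Each member of the union is the closure of [prec] with [p] adjoined. *)
by apply: XU => p _; apply: Xsmallest.
Qed.

End HornConditions.

Theorem proposition6p7 (S : signature) (V : Type) (L : logic S V)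
    (hL : selfextensional L)
    (d : Order.disp_t) (A : tbLatticeType d) (I : operations S A)
    (prec C : set (A * A))
    (hsp : sp_algebra L I prec C)
    (hC : C `<=` contact_of L I prec) :
  (forall X : set (set (A * A)), [set WO; SI] X -> X (S_rel X prec C)) /\
  (forall X : set (set (A * A)), [set AND; OR] X ->
     updirected X prec C -> X (S_rel X prec C)).
Proof.
split=> X [] ->.
- exact: (S_rel_horn _ _ _ WO_smallest (WO_bigcup _ _ _)).
- exact: (S_rel_horn _ _ _ SI_smallest (SI_bigcup _ _ _)).
- move=> /updirected_family dirC.
  exact: (S_rel_horn _ _ _ AND_smallest (AND_bigcup _ _ _ dirC)).
- move=> /updirected_family dirC.
  exact: (S_rel_horn _ _ _ OR_smallest (OR_bigcup _ _ _ dirC)).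
Qed.
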